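(* $M(\epsilon)\ge \operatorname{twr}(1/\epsilon^{c})$ with $c=1/6$, that is, $M(\epsilon)\ge\operatorname{twr}(1/\epsilon^{1/6})$.
   Context: For vertex sets $A,B$ in a graph $G$, let $d_G(A,B)=e(A,B)/(|A||B|)$, where $e(A,B)$ is the number of edges of $G$ with one vertex in $A$ and the other in $B$. The pair $(A,B)$ is $\epsilon$-regular if $|d_G(A,B)-d_G(A',B')|\le\epsilon$ for all $A'\subseteq A$ and $B'\subseteq B$ satisfying $|A'|\ge\epsilon|A|$ and $|B'|\ge\epsilon|B|$. A partition $\mathcal{Z}=\{Z_1,\ldots,Z_k\}$ of the vertex set of a graph is an equipartition if all the sizes of the sets $Z_i$ differ by at most $1$; its order is the number $k$ of sets in it. The equipartition is $\epsilon$-regular if all but $\epsilon k^2$ of the pairs $(Z_i,Z_j)$ are $\epsilon$-regular, where the sets $Z_i,Z_j$ in a pair are not required to be distinct. For $\epsilon>0$, $M(\epsilon)$ is the bound in Szemerédi's regularity lemma: a number such that every graph has an $\epsilon$-regular equipartition of order at most $M(\epsilon)$. $\operatorname{twr}(x)$ denotes a tower of exponents of height $x$.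
   Formalization: The bound is proved for all sufficiently small ε>0 (below some absolute ε_0) rather than every ε>0; it fails at ε=1, where the one-part partition is always 1-regular, so M(1)=1, but twr(1)=2. *)

(* Defs.v *)
From HB Require Import structures.
From mathcomp Require Import all_boot all_order all_algebra.
From mathcomp Require Import reals exp.

Set Implicit Arguments.
Unset Strict Implicit.
Unset Printing Implicit Defensive.

Import Order.TTheory GRing.Theory Num.Theory.

Local Open Scope ring_scope.

Record sgraph := SGraph {
  vertex :> finType;
  adj : rel vertex;
  adj_sym : symmetric adj;
  adj_irrefl : irreflexive adj
}.

(* Ordered pairs (a, b) in A x B with ab an edge: for disjoint A and B this   *)
(* is the number of edges between them; an edge with both ends in A :&: B     *)
(* counts twice, so that the density below always lies in [0, 1].             *)
Definition edges (G : sgraph) (A B : {set G}) : nat :=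
  #|[set p in setX A B | adj p.1 p.2]|.

Definition density (R : realType) (G : sgraph) (A B : {set G}) : R :=
  (edges A B)%:R / (#|A|%:R * #|B|%:R).

Definition regular_pair (R : realType) (eps : R) (G : sgraph)
    (A B : {set G}) : bool :=
  [forall A' : {set G}, forall B' : {set G},
    [&& A' \subset A, B' \subset B,
        eps * #|A|%:R <= #|A'|%:R & eps * #|B|%:R <= #|B'|%:R] ==>
    (`|density R A B - density R A' B'| <= eps)].

(* [partition] requires the parts to be nonempty; the order of Z is #|Z|.     *)
Definition equipartition (G : sgraph) (Z : {set {set G}}) : bool :=
  partition Z [set: G] &&
  [forall A in Z, forall B in Z, (#|A| <= #|B| + 1)%N].

(* Pairs are ordered and may be diagonal, so there are #|Z| ^ 2 of them.      *)
Definition regular_equipartition (R : realType) (eps : R) (G : sgraph)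
    (Z : {set {set G}}) : bool :=
  equipartition Z &&
  (#|[set p in setX Z Z | ~~ regular_pair eps p.1 p.2]|%:R
     <= eps * #|Z|%:R ^+ 2).

(* M is an admissible value of M(eps) in the regularity lemma.                *)
Definition regularity_bound (R : realType) (eps : R) (M : nat) : Prop :=
  forall G : sgraph,
    exists2 Z : {set {set G}}, regular_equipartition eps Z & (#|Z| <= M)%N.

(* Tower of twos whose height is x >= 0 rounded up: twr 0 = 1, twr 1 = 2,     *)
(* twr 2 = 4, twr 3 = 16. Rounding up dominates every nondecreasing extension *)
(* of the tower function from natural to real heights.                        *)
Definition twr (R : realType) (x : R) : nat :=
  iter `|Num.ceil x|%N (expn 2) 1%N.

(* Main.v *)
Require Import Defs.
From HB Require Import structures.
From mathcomp Require Import all_boot all_order all_algebra.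
From mathcomp Require Import reals exp.
From mathcomp Require Import zify ring lra.

(* Take a chain of nested partitions of V in which the number of blocks grows *)
(* exponentially from one level to the next, and for every ordered pair of    *)
(* level-r blocks X, X' an equitable bipartition of X into unions of children *)
(* of X; let the graph of level r join the corresponding halves of X and X'.  *)
(* The bipartitions of X come from a code of positive relative distance, so   *)
(* that any subset of X not concentrated on one child is split by a constant  *)
(* fraction of them. The final graph superposes s levels with equal weight    *)
(* on a blow-up of V.                                                         *)
(*                                                                            *)
(* In an eps-regular equipartition, suppose that a part Z is almost contained *)
(* in a level-r block X but in no child of X. For a constant fraction of the  *)
(* blocks X', both halves Z1, Z2 of Z are large; coarser levels do not        *)
(* distinguish Z1 from Z2, and finer ones contribute to every vertex exactly  *)
(* half of each half of X', so the degrees of Z1 and Z2 into a half of X'     *)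
(* differ by exactly the contribution of level r. Summing over X' and over    *)
(* the parts Z', a proportion of order 1/s of the pairs (Z, Z') is irregular. *)
(* Hence all but O(s eps) of the parts that are almost contained in a block   *)
(* of level r are almost contained in a block of level r+1. When s^3 eps is   *)
(* small, some part is almost contained in a block of the last level, which   *)
(* bounds the order of the partition from below by the number of blocks.      *)

Set Implicit Arguments.
Unset Strict Implicit.
Unset Printing Implicit Defensive.

Import Order.TTheory GRing.Theory Num.Theory.

(** [exists_code] yields a code whose size is exponential in the number of blocks, so each use of
    [tower_extend] adds one exponential, and [exists_tower] reaches tower size with a number of
    levels linear in the height. [split_or_concentrated] says that a part is either concentrated on
    one child or split by many bipartitions; [card_half_block_nbr] gives the exact degree gap that
    such a split creates. [many_irregular] combines them: a part lost between two levels has many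
    irregular partners.

    [few_unlocated] adds up the losses: order [s * eps] of the parts per level, hence [s^2 * eps] in
    all. Using this inside [many_irregular] costs another factor [s], which is why [s^3 * eps] must
    be small. With [s] about [eps^(-1/6)] this quantity is about [eps^(1/2)], leaving room for the
    constants. *)

(** * Codes of positive relative distance *)

Lemma card_light_words (T : finType) :
  (#|[set w : {ffun T -> bool} | 8 * #|[set t | w t]| < #|T|]| ^ 8
     <= 64 ^ #|T|).
Proof.
set m := #|T|; set W := [set w | _].
(* Markov's inequality for the weight [2 ^ (m - |w|)]. *)
have sum3 : (\sum_(w : {ffun T -> bool}) 2 ^ (m - #|[set t | w t]|) = 3 ^ m).
  transitivity (\sum_(w : {ffun T -> bool}) \prod_t (if ~~ w t then 2 else 1)).
    apply: eq_bigr => w _; rewrite -big_mkcond /m -(cardsC [set t | w t]) addKn.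
    rewrite (eq_bigl (mem (~: [set t | w t]))); last by move=> t; rewrite !inE.
    by rewrite prod_nat_const.
  rewrite -(bigA_distr_bigA (fun (_ : T) b => if ~~ b then 2 else 1)) /=.
  rewrite (eq_bigr (fun=> 3)); last by move=> t _; rewrite big_bool.
  by rewrite prod_nat_const.
have leW : (#|W| * 2 ^ (m - m %/ 8) <= 3 ^ m).
  rewrite -sum3 [leqRHS](bigID (mem W)) /= -sum_nat_const.
  apply: leq_trans (leq_addr _ _); apply: leq_sum => w; rewrite inE => lt_w.
  by rewrite leq_exp2l //; lia.
(* Eighth powers avoid fractional exponents; the numerical fact is
   [3^8 = 6561 <= 8192 = 2^7 * 64]. *)
have : ((#|W| * 2 ^ (m - m %/ 8)) ^ 8 <= (3 ^ m) ^ 8) by rewrite leq_exp2r.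
rewrite expnMn -!expnM => le1.
have le2 : (2 ^ (7 * m) <= 2 ^ ((m - m %/ 8) * 8)) by rewrite leq_exp2l //; lia.
have le3 : (3 ^ (m * 8) <= 2 ^ (7 * m) * 64 ^ m).
  rewrite mulnC expnM [2 ^ (7 * m)]expnM -expnMn.
  have le_base : (3 ^ 8 <= 2 ^ 7 * 64) by vm_compute.
  have [->|m_gt0] := posnP m; first by rewrite !expn0.
  by rewrite leq_exp2r.
rewrite -(@leq_pmul2l (2 ^ (7 * m))) ?expn_gt0 //.
apply: leq_trans le3; apply: leq_trans le1.
by rewrite mulnC leq_mul2l le2 orbT.
Qed.

Lemma leq_card_bigcup (I T : finType) (A : {set I}) (F : I -> {set T}) :
  (#|\bigcup_(i in A) F i| <= \sum_(i in A) #|F i|).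
Proof.
elim/big_rec2: _ => [|i m B _ leBm]; first by rewrite cards0.
by rewrite cardsU (leq_trans (leq_subr _ _)) // leq_add2l.
Qed.

(** Gilbert-Varshamov: the balls of radius [m/8] around the words of a maximal code and around their
    complements cover the cube, and [card_light_words] bounds each ball. Distance from complements
    ([b = true]) is required because [tower_extend] uses every codeword together with its
    complement. *)
Lemma exists_code (T : finType) : (0 < #|T|) ->
  exists2 C : {set {ffun T -> bool}}, (4 ^ #|T| <= (2 * #|C|) ^ 8) &
    {in C &, forall c d : {ffun T -> bool}, c != d -> forall b : bool,
      #|T| <= 8 * #|[set t | c t != d t (+) b]|}.
Proof.
move=> T_gt0; set m := #|T|.
pose code (C : {set {ffun T -> bool}}) :=
  [forall c : {ffun T -> bool} in C, forall d : {ffun T -> bool} in C,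
    (c != d) ==> [forall b : bool, (m <= 8 * #|[set t | c t != d t (+) b]|)]].
have code0 : code set0 by apply/forall_inP => c; rewrite inE.
have [C codeC maxC] := arg_maxnP (fun C : {set _} => #|C|) code0.
exists C; last first.
  move=> c d cC dC ne_cd b; move: codeC => /forall_inP/(_ c cC).
  by move=> /forall_inP/(_ d dC)/implyP/(_ ne_cd)/forallP/(_ b).
pose W := [set w : {ffun T -> bool} | (8 * #|[set t | w t]| < m)].
pose sh (p : {ffun T -> bool} * bool) (w : {ffun T -> bool}) : {ffun T -> bool} :=
  [ffun t => w t (+) (p.1 t (+) p.2)].
have shK p : involutive (sh p).
  by move=> w; apply/ffunP => t; rewrite !ffunE addbK.
have mem_sh w c b :
    (w \in sh (c, b) @: W) = (8 * #|[set t | w t != c t (+) b]| < m).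
  rewrite -{1}(shK (c, b) w) mem_imset; last exact: can_inj (shK _).
  by rewrite inE; congr (8 * _ < _); apply: eq_card => t;
    rewrite !inE ffunE /=; case: (w t) (c t) b => [] [] [].
have cover : [set: {ffun T -> bool}] \subset
    \bigcup_(p in setX C [set: bool]) sh p @: W.
  apply/subsetP => w _; apply/bigcupP.
  have [[c [b /andP[cC lt_cb]]]|far] :
      (exists c b, (c \in C) && (8 * #|[set t | w t != c t (+) b]| < m)) \/
      (forall c b, c \in C -> (m <= 8 * #|[set t | w t != c t (+) b]|)).
  - case: (boolP [exists c, exists b : bool,
      (c \in C) && (8 * #|[set t | w t != c t (+) b]| < m)]) => [/existsP[c]|].
      by move=> /existsP[b h]; left; exists c, b.
    rewrite negb_exists => /forallP h; right => c b cC; move: (h c).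
    by rewrite negb_exists => /forallP/(_ b); rewrite cC -leqNgt.
  - by exists (c, b); rewrite ?mem_sh // !inE cC.
  have wC : w \notin C.
    apply/negP => /(far w false); rewrite (_ : [set _ | _] = set0) ?cards0.
      by rewrite muln0 leqNgt T_gt0.
    by apply/setP => t; rewrite !inE addbF eqxx.
  have : code (w |: C).
    apply/forall_inP => c; rewrite !inE => cC; apply/forall_inP => d.
    rewrite !inE => dC; apply/implyP => ne_cd; apply/forallP => b.
    case/orP: cC dC ne_cd => [/eqP->|cC] /orP[/eqP->|dC] ne_cd.
    - by rewrite eqxx in ne_cd.
    - exact: far.
    - have := far c b cC; congr (_ <= 8 * _); apply: eq_card => t.
      by rewrite !inE; case: (w t) (c t) b => [] [] [].
    - move: codeC => /forall_inP/(_ c cC).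
      by move=> /forall_inP/(_ d dC)/implyP/(_ ne_cd)/forallP/(_ b).
  by move=> /maxC; rewrite cardsU1 wC /=; lia.
have le2 : (2 ^ m <= 2 * #|C| * #|W|).
  have := subset_leq_card cover; rewrite cardsT card_ffun card_bool => h.
  apply: leq_trans h _; apply: leq_trans (leq_card_bigcup _ _) _.
  rewrite (eq_bigr (fun=> #|W|)); last first.
    by move=> p _; apply: card_imset; exact: can_inj (shK p).
  by rewrite sum_nat_const cardsX cardsT card_bool [#|C| * 2]mulnC.
have : ((2 ^ m) ^ 8 <= (2 * #|C| * #|W|) ^ 8) by rewrite leq_exp2r.
rewrite expnMn => /leq_trans/(_ (leq_mul (leqnn _) (card_light_words T))).
rewrite -expnM mulnC expnM (_ : (2 ^ 8 = 4 * 64)) // expnMn leq_pmul2r //.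
by rewrite expn_gt0.
Qed.

(** * Towers of nested partitions with separating bipartitions *)

(* [P r] maps a vertex to a label of its level-r block, and [sg r x l] is the  *)
(* side of [x] in the bipartition of its level-r block that is associated      *)
(* with the block labelled [l]. Labels are vertices, and a label may denote    *)
(* the empty block.                                                            *)
Record splitting_tower (s : nat) (V : finType) (P : nat -> V -> V)
    (sg : nat -> V -> V -> bool) : Prop := SplittingTower {
  tower_root : forall v w, P 0 v = P 0 w;
  tower_leaf : forall v, P s v = v;
  tower_refine : forall r v w, (r < s) -> P r.+1 v = P r.+1 w -> P r v = P r w;
  tower_bit : forall r v w l, (r < s) -> P r.+1 v = P r.+1 w ->
    sg r v l = sg r w l;
  tower_balanced : forall r l l', (r < s) ->
    (#|[set y | P r y == l & sg r y l']|.*2 = #|[set y | P r y == l]|);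
  tower_separated : forall r v w, (r < s) ->
    P r v = P r w -> P r.+1 v != P r.+1 w ->
    (#|V| <= 8 * #|[set y | sg r v (P r y) != sg r w (P r y)]|)
}.

Lemma card_half_involution (T : finType) (A f : pred T) (h : T -> T) :
  involutive h -> (forall y, A (h y) = A y) -> (forall y, f (h y) = ~~ f y) ->
  (#|[set y | A y & f y]|.*2 = #|[set y | A y]|).
Proof.
move=> hK Ah fh; rewrite -(cardsID [set y | f y] [set y | A y]) -addnn.
congr (_ + _); first by apply: eq_card => y; rewrite !inE.
rewrite -(card_imset _ (can_inj hK)); apply: eq_card => y.
by rewrite -{1}(hK y) mem_imset ?inE ?Ah ?fh 1?andbC //; exact: can_inj hK.
Qed.

Lemma card_preim_fst (V W : finType) (A : pred V) :
  #|[set y : V * W | A y.1]| = (#|[set x | A x]| * #|W|).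
Proof.
rewrite -cardsT -cardsX; apply: eq_card => -[x w].
by rewrite !inE andbT.
Qed.

(** Every leaf gets one child for each codeword [c] and bit [b], lying on side [c l (+) b] of the
    bipartition indexed by [l]. Flipping [b] makes the bipartitions balanced, the code distance
    separates the children, and the older levels are pulled back. The growth factor [2 * #|C|] is at
    least [2 ^ (#|V| / 4)]. *)
Lemma tower_extend (s : nat) (V : finType) P (sg : nat -> V -> V -> bool) :
  splitting_tower s P sg -> (0 < #|V|) ->
  exists (V' : finType) P' (sg' : nat -> V' -> V' -> bool),
    [/\ splitting_tower s.+1 P' sg', (2 * #|V| <= #|V'|) &
        forall T, (4 * T <= #|V| -> 2 ^ T * #|V| <= #|V'|)].
Proof.
move=> tow V_gt0; have [C leC codeC] := exists_code V_gt0.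
have C_gt0 : (0 < #|C|).
  rewrite lt0n; apply/eqP => C0; move: leC.
  by rewrite C0 muln0 leqNgt exp0n // expn_gt0.
have [c0 c0C] := card_gt0P C_gt0.
pose W : finType := ({c : {ffun V -> bool} | c \in C} * bool)%type.
have cardW : #|W| = (2 * #|C|) by rewrite card_prod card_sig card_bool mulnC.
(* Labels must be vertices of the new set, so labels of old blocks carry the dummy second component
   [e0]; at these levels a label with another second component denotes an empty block. *)
pose e0 : W := (exist (fun c => c \in C) c0 c0C, false).
pose P' r (v : V * W) := if (r <= s) then (P r v.1, e0) else v.
pose sg' r (v l : V * W) := if (r < s) then sg r v.1 l.1
  else sval v.2.1 l.1 (+) v.2.2.
have P'E r v : (r <= s) -> P' r v = (P r v.1, e0) by rewrite /P' => ->.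
have P'S v : P' s.+1 v = v by rewrite /P' ltnn.
have sg'E r v l : (r < s) -> sg' r v l = sg r v.1 l.1 by rewrite /sg' => ->.
have sg's v l : sg' s v l = sval v.2.1 l.1 (+) v.2.2 by rewrite /sg' ltnn.
have card_V' : #|{: V * W}| = (#|V| * #|W|) by rewrite card_prod.
exists (V * W)%type, P', sg'; split; last first.
- move=> T leT; rewrite card_V' mulnC leq_mul2l cardW; apply/orP; right.
  rewrite -(@leq_exp2r _ _ 8) //; apply: leq_trans leC.
  by rewrite -expnM (_ : 4 = 2 ^ 2) // -expnM leq_exp2l //; lia.
- by rewrite card_V' cardW mulnC leq_mul2l leq_pmulr ?orbT.
split.
- by move=> v w; rewrite !P'E //; congr pair; exact: tower_root tow _ _.
- exact: P'S.
- move=> r v w; rewrite ltnS leq_eqVlt => /predU1P[->|lt_rs].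
    by rewrite !P'S => ->.
  rewrite !P'E // ?(ltnW lt_rs) // => -[eqP].
  by rewrite (tower_refine tow lt_rs eqP).
- move=> r v w l; rewrite ltnS leq_eqVlt => /predU1P[->|lt_rs].
    by rewrite !P'S => ->.
  rewrite !P'E // !sg'E // => -[eqP]; exact: (tower_bit tow).
- move=> r [l e] [l' e']; rewrite ltnS leq_eqVlt => /predU1P[->|lt_rs].
    apply: (@card_half_involution _ (fun y => P' s y == (l, e))
      (fun y => sg' s y (l', e')) (fun y => (y.1, (y.2.1, ~~ y.2.2)))).
    + by move=> [x [c b]] /=; rewrite negbK.
    + by move=> y; rewrite !P'E.
    + by move=> y; rewrite !sg's /= addbN.
  have P'eq y : (P' r y == (l, e)) = (P r y.1 == l) && (e0 == e).
    by rewrite P'E ?(ltnW lt_rs).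
  have [ee0|ne_e] := eqVneq e e0; last first.
    have P'F y : (P' r y == (l, e)) = false.
      by rewrite P'eq [e0 == e]eq_sym (negPf ne_e) andbF.
    have -> : #|[set y | P' r y == (l, e)]| = 0.
      by apply: eq_card0 => y; rewrite inE P'F.
    by apply/eqP; rewrite double_eq0 cards_eq0; apply/eqP/setP => y;
      rewrite !inE P'F.
  transitivity (#|[set y | P r y == l & sg r y l']|.*2 * #|W|).
    rewrite -doubleMl -card_preim_fst; congr _.*2; apply: eq_card => y.
    by rewrite !inE P'eq ee0 eqxx andbT sg'E.
  rewrite (tower_balanced tow) // -card_preim_fst; apply: eq_card => y.
  by rewrite !inE P'eq ee0 eqxx andbT.
- move=> r [x e] [x' e']; rewrite ltnS leq_eqVlt => /predU1P[->|lt_rs];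
  last first.
    rewrite !P'E ?(ltnW lt_rs) // => -[eqP]; rewrite xpair_eqE eqxx andbT => neP.
    have := tower_separated tow lt_rs eqP neP.
    rewrite card_V' -(@leq_pmul2r #|W|); last by rewrite cardW muln_gt0.
    rewrite -mulnA -card_preim_fst => /leq_trans; apply.
    rewrite leq_mul2l /=; apply: subset_leq_card; apply/subsetP => y.
    by rewrite !inE !sg'E // P'E ?(ltnW lt_rs).
  rewrite !P'S !P'E ?leqnn // !(tower_leaf tow) => -[->] {x}.
  case: e e' => [c b] [c' b'] ne; rewrite card_V'.
  (* Two children with the same codeword have opposite bits, so every bipartition separates them. *)
  have [eq_c|ne_c] := eqVneq c c'.
    have ne_b : b != b' by apply: contraNneq ne => ->; rewrite eq_c.
    rewrite (_ : [set _ | _] = setT) ?cardsT ?card_V' ?leq_pmull //.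
    apply/setP => y; rewrite !inE !sg's /= eq_c.
    by move: ne_b; case: (_ (P' s y).1); clear ne; case: b b' => [] [].
  have /codeC/(_ (b (+) b')) : sval c != sval c' by [].
  move=> /(_ (valP c) (valP c')).
  rewrite -(@leq_pmul2r #|W|); last by rewrite cardW muln_gt0.
  rewrite -mulnA -card_preim_fst => /leq_trans; apply.
  rewrite leq_mul2l /=; apply: subset_leq_card; apply/subsetP => y.
  rewrite !inE !sg's P'E // (tower_leaf tow) /=.
  by clear ne; case: (sval c y.1) (sval c' y.1) b b' => [] [] [] [].
Qed.

(** Two doublings of a point give the initial four vertices. The factor 4 is what the growth clause
    of [tower_extend] consumes, and [#|V| >= 4] restores it afterwards. *)
Lemma exists_tower (h : nat) :
  exists (V : finType) P (sg : nat -> V -> V -> bool),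
    splitting_tower h.+2 P sg /\ (4 * iter h (expn 2) 1 <= #|V|).
Proof.
elim: h => [|h [V [P [sg [tow le_V]]]]].
  have tow0 : splitting_tower 0 (fun=> @id unit) (fun _ _ _ => false).
    by split => // - [] [].
  have [|V1 [P1 [sg1 [tow1 le1 _]]]] := tower_extend tow0;
    first by rewrite card_unit.
  rewrite card_unit in le1.
  have [|V2 [P2 [sg2 [tow2 le2 _]]]] := tower_extend tow1;
    first exact: leq_trans le1.
  exists V2, P2, sg2; split=> //=; exact: leq_trans (leq_mul (leqnn 2) le1) le2.
have V_gt0 : (3 < #|V|).
  by apply: leq_trans le_V; case: h {tow} => [|h] //=;
    rewrite leq_pmulr ?expn_gt0.
have [|V' [P' [sg' [tow' _ leV']]]] := tower_extend tow;
  first exact: leq_trans V_gt0.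
exists V', P', sg'; split=> //=; apply: leq_trans (leV' _ le_V).
by rewrite mulnC leq_mul2l V_gt0 orbT.
Qed.

(** * The superposed graph and its degrees *)

Definition level_edge (V : finType) (P : nat -> V -> V)
    (sg : nat -> V -> V -> bool) (r : nat) (x y : V) : bool :=
  sg r x (P r y) == sg r y (P r x).

(* Each vertex [u] has exactly one [w.2] with [u.2.2 != w.2.2] and             *)
(* [u.2.1 + w.2.1 = r] for each level [r], so the number of neighbours of [u]  *)
(* in a union of fibres is exactly the sum of the degrees over all levels. The *)
(* boolean only serves to make the relation irreflexive.                       *)
Definition tower_adj (s : nat) (V : finType) (P : nat -> V -> V)
    (sg : nat -> V -> V -> bool) : rel (V * ('I_s.+1 * bool)) :=
  fun u w => (u.2.2 != w.2.2) && level_edge P sg (u.2.1 + w.2.1 : 'I_s.+1)%R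
    u.1 w.1.

Lemma tower_adj_sym s (V : finType) P (sg : nat -> V -> V -> bool) :
  symmetric (tower_adj (s := s) P sg).
Proof.
by move=> u w; rewrite /tower_adj /level_edge addrC eq_sym; congr andb;
  exact: eq_sym.
Qed.

Lemma tower_adj_irrefl s (V : finType) P (sg : nat -> V -> V -> bool) :
  irreflexive (tower_adj (s := s) P sg).
Proof. by move=> u; rewrite /tower_adj eqxx. Qed.

Definition tower_graph s (V : finType) P (sg : nat -> V -> V -> bool) : sgraph :=
  SGraph (@tower_adj_sym s V P sg) (@tower_adj_irrefl s V P sg).

Lemma card_tower_nbr s (V : finType) P (sg : nat -> V -> V -> bool)
    (u : tower_graph s P sg) (S : {set V}) :
  #|[set w : tower_graph s P sg | adj u w & w.1 \in S]| =
    (\sum_(r < s.+1) #|[set y in S | level_edge P sg r u.1 y]|).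
Proof.
rewrite -sum1_card.
pose a := u.2.1 : 'I_s.+1; pose g (w : V * ('I_s.+1 * bool)) := (a + w.2.1)%R.
rewrite (partition_big g xpredT) //= /g.
apply: eq_bigr => r _; rewrite sum1dep_card.
pose f (y : V) : V * ('I_s.+1 * bool) := (y, ((r - a)%R, ~~ u.2.2)).
have f_inj : injective f by move=> x y [].
rewrite -(card_imset _ f_inj); apply: eq_card => -[x [a' b]].
apply/idP/imsetP => [|[y]]; rewrite !inE.
  rewrite /tower_adj /= -/a => /andP[/andP[/andP[ne_b edge] xS] /eqP defr].
  exists x; first by rewrite inE xS -defr.
  by rewrite /f -defr addrC addKr; congr (_, (_, _)); case: (u.2.2) b ne_b =>
    [] [].
move=> /andP[yS edge] [-> -> ->].
have ar : (a + (r - a))%R = r by rewrite addrC subrK.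
by rewrite ar yS eqxx !andbT /tower_adj -[X in level_edge P sg X]/(val (a + (r - a))%R)
  ar edge; case: (u.2.2).
Qed.

Lemma tower_refine_le s (V : finType) P (sg : nat -> V -> V -> bool) :
  splitting_tower s P sg -> forall r r' v w, (r <= r' <= s) ->
  P r' v = P r' w -> P r v = P r w.
Proof.
move=> tow r r' v w /andP[le_rr' le_r's].
elim: r' le_rr' le_r's => [|r' IH]; first by rewrite leqn0 => /eqP->.
rewrite leq_eqVlt => /predU1P[->//|lt_rr'] lt_r's /(tower_refine tow lt_r's).
by apply: IH => //; exact: ltnW.
Qed.

Definition half_block (V : finType) (P : nat -> V -> V)
    (sg : nat -> V -> V -> bool) (r : nat) (x l : V) : {set V} :=
  [set y | P r y == l & sg r y (P r x)].

Lemma card_fibers (T I : finType) (f : T -> I) (A : {set T}) :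
  #|A| = (\sum_i #|[set y in A | f y == i]|).
Proof.
rewrite -sum1_card (partition_big f xpredT) //=.
by apply: eq_bigr => i _; rewrite sum1dep_card.
Qed.

(* Every block of a level finer than [r] is either disjoint from a half block  *)
(* of level [r] or contained in it.                                            *)
Lemma card_fine_edges s (V : finType) P (sg : nat -> V -> V -> bool) r r' x l v :
  splitting_tower s P sg -> (r < r' < s) ->
  (#|[set y in half_block P sg r x l | level_edge P sg r' v y]|.*2
     = #|half_block P sg r x l|).
Proof.
move=> tow /andP[lt_rr' lt_r's]; set S := half_block _ _ _ _ _.
rewrite (card_fibers (P r') S) (card_fibers (P r')) -mul2n big_distrr /=.
apply: eq_bigr => m _; rewrite mul2n.
have [/existsP[z /andP[zS /eqP zm]]|none] :=
  boolP [exists z, (z \in S) && (P r' z == m)];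
  last first.
  rewrite negb_exists in none; move/forallP in none.
  rewrite !eq_card0 // => y; rewrite inE; first exact/negbTE/none.
  by apply: contraNF (none y) => /andP[]; rewrite inE => /andP[-> _] ->.
have inS y : P r' y == m -> y \in S.
  rewrite -zm => /eqP Pyz; move: zS; rewrite !inE.
  have Pr1 : P r.+1 y = P r.+1 z by apply: (tower_refine_le tow _ Pyz);
    rewrite lt_rr' ltnW.
  have lt_rs := ltn_trans lt_rr' lt_r's.
  by rewrite (tower_refine tow lt_rs Pr1) (tower_bit tow _ lt_rs Pr1).
have -> : [set y in S | P r' y == m] = [set y | P r' y == m].
  by apply/setP => y; rewrite !inE; apply: andb_idl => /inS; rewrite !inE.
(* Inside the fine block [m] the bit [sg r' v m] is fixed, so the neighbours of [v] form one side of
   a balanced bipartition of [m]. *)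
have -> : [set y in [set y in S | level_edge P sg r' v y] | P r' y == m]
  = [set y | P r' y == m & sg r' v m == sg r' y (P r' v)].
  apply/setP => y; rewrite !inE /level_edge; case: (P r' y =P m) => [Pym|];
    last by rewrite !andbF.
  by move: (inS y); rewrite Pym eqxx inE andbT => ->.
have bal := tower_balanced tow m (P r' v) lt_r's.
case: (sg r' v m); first by rewrite -bal; congr _.*2; apply: eq_card => y;
  rewrite !inE eq_sym eqb_id.
have := cardsID [set y | sg r' y (P r' v)] [set y | P r' y == m].
have -> : [set y | P r' y == m] :\: [set y | sg r' y (P r' v)]
    = [set y | P r' y == m & false == sg r' y (P r' v)].
  by apply/setP => y; rewrite !inE andbC; case: (sg _ _ _).
have -> : [set y | P r' y == m] :&: [set y | sg r' y (P r' v)]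
    = [set y | P r' y == m & sg r' y (P r' v)].
  by apply/setP => y; rewrite !inE.
move: bal; lia.
Qed.

(** Levels coarser than [r] do not distinguish [u] from [x], and finer ones contribute exactly half
    of the half block by [card_fine_edges]; together they make [K]. At level [r] the vertex [u] sees
    all or none of the half block, according to its bit. *)
Lemma card_half_block_nbr s (V : finType) P (sg : nat -> V -> V -> bool) r x l :
  splitting_tower s.+1 P sg -> (r < s.+1) ->
  exists K, forall u : tower_graph s P sg, P r u.1 = P r x ->
    #|[set w : tower_graph s P sg | adj u w & w.1 \in half_block P sg r x l]| =
    (K + sg r u.1 l * #|half_block P sg r x l|).
Proof.
move=> tow lt_rs; set S := half_block _ _ _ _ _; pose r0 := Ordinal lt_rs.
exists (\sum_(r' < s.+1 | r' != r0) #|[set y in S | level_edge P sg r' x y]|).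
move=> u Pux; rewrite card_tower_nbr (bigD1 r0) //= addnC; congr (_ + _).
  apply: eq_bigr => r'; rewrite -val_eqE /= neq_ltn => /orP[lt_r'r|lt_rr'].
    apply: eq_card => y; rewrite !inE /level_edge.
    have Pr1 : P r'.+1 u.1 = P r'.+1 x.
      by apply: (tower_refine_le tow _ Pux); rewrite lt_r'r ltnW.
    by rewrite (tower_refine tow (ltn_ord r') Pr1) (tower_bit tow _ (ltn_ord
      r') Pr1).
  have lt : (r < r' < s.+1) by rewrite lt_rr' ltn_ord.
  by apply: double_inj; rewrite !(card_fine_edges _ _ _ tow lt).
case: (boolP (sg r u.1 l)) => [sgu|/negPf sgu]; rewrite ?mul1n ?mul0n.
  apply: eq_card => y; rewrite !inE /level_edge Pux andb_idr //.
  by move=> /andP[/eqP-> ->]; rewrite sgu.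
apply/eqP; rewrite cards_eq0; apply/eqP/setP => y; rewrite !inE /level_edge Pux.
by case: eqP => //= ->; case: (sg r y _); rewrite // sgu.
Qed.

Local Open Scope ring_scope.

(** * Splitting a set by the bipartitions of its block *)

Lemma sum_discordant (T : finType) (Z : {set T}) (a : pred T) :
  (\sum_(u in Z) \sum_(w in Z) (a u != a w) =
     2 * (#|[set u in Z | a u]| * #|[set u in Z | ~~ a u]|))%N.
Proof.
have inner u : (\sum_(w in Z) (a u != a w) =
    if a u then #|[set w in Z | ~~ a w]| else #|[set w in Z | a w]|)%N.
  rewrite -!sum1dep_card; case: (a u);
    rewrite [LHS]big_mkcond [RHS]big_mkcond /=; apply: eq_bigr => w _;
      by case: (w \in Z); case: (a w).
rewrite (eq_bigr _ (fun u _ => inner u)) (bigID a) /=.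
rewrite (eq_bigr (fun=> #|[set w in Z | ~~ a w]|)); last by move=> u /andP[_ ->].
rewrite [X in (_ + X)%N](eq_bigr (fun=> #|[set w in Z | a w]|)); last first.
  by move=> u /andP[_ /negPf->].
rewrite !sum_nat_cond_const mul2n -addnn; congr (_ + _)%N; last by rewrite mulnC.
Qed.

(** A reverse Markov argument. Take [u] with the fewest elements [D u] of [Z] outside its child.
    Double counting the separated pairs shows that the product of the two sides of [Z] averages at
    least [#|Z| * #|D u| / 16] over [y], while it never exceeds [#|Z| * #|D u|] and is at most
    [#|Z| * tau] when [y] is not good. If [#|D u| > 32 * tau], the latter terms supply less than
    half of the average. *)
Lemma split_or_concentrated (R : realFieldType) s (V : finType) P
    (sg : nat -> V -> V -> bool) r x (T : finType) (p : T -> V) (Z : {set T})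
    (tau : R) :
  splitting_tower s P sg -> (r < s)%N -> Z != set0 ->
  {in Z, forall u, P r (p u) = P r x} ->
  (exists2 u, u \in Z &
     (#|[set w in Z | P r.+1 (p u) != P r.+1 (p w)]|%:R <= 32 * tau)) \/
  (#|V|%:R <= 32 * #|[set y | (tau <= #|[set u in Z | sg r (p u) (P r y)]|%:R)
     && (tau <= #|[set u in Z | ~~ sg r (p u) (P r y)]|%:R)]|%:R :> R).
Proof.
move=> tow lt_rs /set0Pn[u0 u0Z] Pxr.
pose D u := [set w in Z | P r.+1 (p u) != P r.+1 (p w)].
have [u uZ minD] := arg_minnP (fun u => #|D u|) u0Z.
pose A y := [set u in Z | sg r (p u) (P r y)].
pose B y := [set u in Z | ~~ sg r (p u) (P r y)].
set good := [set y | _].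
have leD : (#|V| * (#|Z| * #|D u|) <= 16 * \sum_y #|A y| * #|B y|)%N.
  rewrite (_ : 16 = 8 * 2)%N // -mulnA big_distrr /=.
  rewrite (eq_bigr _ (fun y _ => esym (sum_discordant Z (fun u =>
    sg r (p u) (P r y))))).
  rewrite exchange_big /= mulnCA -sum_nat_const big_distrr /=;
    apply: leq_sum => v vZ.
  rewrite exchange_big /=; apply: leq_trans (leq_mul (leqnn _) (minD v vZ)) _.
  rewrite mulnC -sum_nat_const big_distrr /= big_mkcond [leqRHS]big_mkcond /=.
  apply: leq_sum => w _; rewrite inE; case: (boolP (w \in Z)) => //= wZ.
  case: ifP => // neq.
  have := tower_separated tow lt_rs _ neq; rewrite !Pxr // =>
    /(_ erefl) /leq_trans; apply.
  by rewrite leq_mul2l /= -sum1dep_card big_mkcond /=; apply: leq_sum => y _;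
    case: (sg r (p v) _) (sg r (p w) _) => [] [].
(* The child of [u] lies entirely on one side, so the other side is contained in [D u]. *)
have leAB y : (#|A y| * #|B y| <= #|Z| * #|D u|)%N.
  have leA : (#|A y| <= #|Z|)%N by apply/subset_leq_card/subsetP => w;
    rewrite inE => /andP[].
  have leB : (#|B y| <= #|Z|)%N by apply/subset_leq_card/subsetP => w;
    rewrite inE => /andP[].
  have [sgu|sgu] := boolP (sg r (p u) (P r y)).
    apply: leq_mul => //; apply/subset_leq_card/subsetP => w; rewrite !inE.
    move=> /andP[-> sgw] /=; apply: contraNneq sgw => eqP.
    by rewrite -(tower_bit tow _ lt_rs eqP).
  rewrite mulnC; apply: leq_mul => //; apply/subset_leq_card/subsetP => w;
    rewrite !inE.
  move=> /andP[-> sgw] /=; apply: contraNneq sgu => eqP.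
  by rewrite (tower_bit tow _ lt_rs eqP).
have Z_gt0 : (0 < #|Z|%:R :> R) by rewrite ltr0n; apply/card_gt0P; exists u0.
have V_gt0 : (0 < #|V|%:R :> R) by rewrite ltr0n; apply/card_gt0P; exists x.
have tau_le y : y \notin good -> (0 <= tau) ->
    ((#|A y| * #|B y|)%:R <= #|Z|%:R * tau).
  have leA : (#|A y|%:R <= #|Z|%:R :> R) by rewrite ler_nat;
    apply/subset_leq_card/subsetP => w; rewrite inE => /andP[].
  have leB : (#|B y|%:R <= #|Z|%:R :> R) by rewrite ler_nat;
    apply/subset_leq_card/subsetP => w; rewrite inE => /andP[].
  rewrite inE negb_and -!ltNge natrM => /orP[lt|lt] tau_ge0.
    by rewrite mulrC; apply: ler_pM => //; exact: ltW.
  by apply: ler_pM => //; exact: ltW.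
have [le_eta|lt_eta] := lerP #|D u|%:R (32 * tau); [by left; exists u | right].
rewrite leNgt; apply/negP => lt_good.
have [tau_lt0|tau_ge0] := ltrP tau 0.
  move: lt_good; rewrite (_ : good = setT) ?cardsT; first lra.
  by apply/setP => y; rewrite !inE !(le_trans (ltW tau_lt0)).
have sum_le : ((\sum_y #|A y| * #|B y|)%:R <=
    #|good|%:R * (#|Z|%:R * #|D u|%:R) + #|V|%:R * (#|Z|%:R * tau) :> R).
  rewrite natr_sum (bigID (mem good)) /=; apply: lerD.
    rewrite mulr_natl -sumr_const; apply: ler_sum => y _.
    by rewrite -natrM ler_nat.
  apply: (@le_trans _ _ (\sum_(y | y \notin good) #|Z|%:R * tau)).
    by apply: ler_sum => y yg; exact: tau_le.
  rewrite sumr_const -[leLHS]mulr_natl; apply: ler_wpM2r.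
    by rewrite mulr_ge0 // ltW.
  by rewrite ler_nat max_card.
have : ((#|V| * (#|Z| * #|D u|))%:R <= (16 * \sum_y #|A y| * #|B y|)%:R :> R).
  by rewrite ler_nat.
rewrite !natrM => le1.
have {le1 sum_le} := le_trans le1 (ler_wpM2l (ler0n _ 16) sum_le).
rewrite (_ : _ * (_ * _) = #|Z|%:R * (#|V|%:R * #|D u|%:R)); last by ring.
rewrite (_ : 16%:R * _ = #|Z|%:R * (16%:R * (#|good|%:R * #|D u|%:R + #|V|%:R *
  tau))); last by ring.
rewrite ler_pM2l // => le1.
have h1 : (0 <= (#|V|%:R - 32 * #|good|%:R) * #|D u|%:R :> R).
  by rewrite mulr_ge0 // subr_ge0 ltW.
have h2 : (0 < #|V|%:R * (#|D u|%:R - 32 * tau) :> R).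
  by rewrite mulr_gt0 // subr_gt0.
nra.
Qed.

(** * Edge counts, equipartitions and average degrees *)

Lemma edges_sum (G : sgraph) (A B : {set G}) :
  edges A B = (\sum_(u in A) #|[set w | adj u w & w \in B]|)%N.
Proof.
rewrite /edges -sum1dep_card (eq_bigl (fun p : G * G =>
  (p.1 \in A) && ((p.2 \in B) && adj p.1 p.2))).
  rewrite -(pair_big_dep (mem A) (fun u w => (w \in B) && adj u w) (fun _ _ =>
    1%N)) /=.
  by apply: eq_bigr => u _; rewrite -sum1dep_card; apply: eq_bigl => w;
    rewrite andbC.
by move=> p; rewrite !inE andbA.
Qed.

Lemma edges_le (G : sgraph) (A B : {set G}) : (edges A B <= #|A| * #|B|)%N.
Proof.
by rewrite -cardsX; apply/subset_leq_card/subsetP => p; rewrite !inE => /andP[].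
Qed.

Lemma sum_partition_setI (T : finType) (Z : {set {set T}}) (S : {set T}) :
  partition Z setT -> (\sum_(B in Z) #|B :&: S| = #|S|)%N.
Proof.
case/and3P => /eqP cov triv _.
transitivity (\sum_(B in Z) \sum_(x in B) (x \in S))%N.
  apply: eq_bigr => B _; rewrite -sum1_card [LHS]big_mkcond [RHS]big_mkcond.
  by apply: eq_bigr => x _; rewrite inE; case: (x \in B); case: (x \in S).
rewrite -(big_trivIset _ triv) cov -sum1_card [RHS]big_mkcond /=.
by apply: eq_big => x; rewrite ?inE //; case: (x \in S).
Qed.

Lemma edges_partition (G : sgraph) (Z : {set {set G}}) (A S : {set G}) :
  partition Z setT -> edges A S = (\sum_(B in Z) edges A (B :&: S))%N.
Proof.
move=> partZ; rewrite edges_sum (eq_bigr _ (fun B _ => edges_sum A (B :&: S))).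
rewrite exchange_big /=; apply: eq_bigr => u _.
rewrite -(sum_partition_setI _ partZ); apply: eq_bigr => B _.
by apply: eq_card => w; rewrite !inE; case: (w \in B); rewrite ?andbF.
Qed.

(** Parts are nonempty, so [#|A| <= #|B| + 1 <= 2 * #|B|] for every part [B]. *)
Lemma equipartition_card (G : sgraph) (Z : {set {set G}}) (A : {set G}) :
  equipartition Z -> A \in Z -> (#|A| * #|Z| <= 2 * #|G|)%N.
Proof.
move=> /andP[partZ /forall_inP eqZ] AZ; have /and3P[_ _ Z0] := partZ.
rewrite -cardsT (card_partition partZ) big_distrr /= mulnC -sum_nat_const.
apply: leq_sum => B BZ; move: (eqZ A AZ) => /forall_inP/(_ B BZ).
have : (0 < #|B|)%N by rewrite card_gt0; apply: contraNneq Z0 => <-.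
lia.
Qed.

(* This is [0] when [A] is empty, by the convention [0^-1 = 0].                *)
Definition avgdeg (R : realType) (G : sgraph) (A X : {set G}) : R :=
  (edges A X)%:R / #|A|%:R.

Lemma avgdeg_ge0 (R : realType) (G : sgraph) (A X : {set G}) : 0 <= avgdeg R A X.
Proof. by rewrite divr_ge0. Qed.

Lemma avgdeg_le (R : realType) (G : sgraph) (A X : {set G}) :
  avgdeg R A X <= #|X|%:R.
Proof.
rewrite /avgdeg; have [->|A0] := eqVneq A set0;
  first by rewrite cards0 invr0 mulr0.
rewrite ler_pdivrMr ?ltr0n ?card_gt0 // -natrM ler_nat mulnC; exact: edges_le.
Qed.

Lemma avgdegE (R : realType) (G : sgraph) (A X : {set G}) :
  avgdeg R A X = density R A X * #|X|%:R.
Proof.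
rewrite /avgdeg /density; have [X0|X0] := eqVneq (#|X|%:R : R) 0.
  rewrite X0 mulr0; move/eqP: X0; rewrite pnatr_eq0 => /eqP X0.
  have := edges_le A X; rewrite X0 muln0 leqn0 => /eqP->.
  by rewrite mul0r.
by rewrite invfM mulrA divfK.
Qed.

(** No lower bound on [X] is assumed: below the regularity threshold, the gap is at most
    [#|X| < eps * #|Z'|]. Otherwise both densities are within [eps] of that of the pair. *)
Lemma regular_avgdeg_gap (R : realType) (eps : R) (G : sgraph)
    (Z Z' A B X : {set G}) :
  0 <= eps -> regular_pair eps Z Z' ->
  A \subset Z -> B \subset Z -> X \subset Z' ->
  eps * #|Z|%:R <= #|A|%:R -> eps * #|Z|%:R <= #|B|%:R ->
  avgdeg R A X - avgdeg R B X <= 2 * eps * #|Z'|%:R.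
Proof.
move=> eps_ge0 reg sAZ sBZ sXZ' leA leB.
have [leX|ltX] := lerP (eps * #|Z'|%:R) (#|X|%:R : R); last first.
  have := avgdeg_le R A X; have := avgdeg_ge0 R B X.
  have : 0 <= eps * #|Z'|%:R by rewrite mulr_ge0.
  lra.
have near (Y : {set G}) : Y \subset Z -> eps * #|Z|%:R <= #|Y|%:R ->
    `|density R Z Z' - density R Y X| <= eps.
  move=> sYZ leY; move/forallP: reg => /(_ Y)/forallP/(_ X)/implyP; apply.
  by rewrite sYZ sXZ' leY leX.
have := near A sAZ leA; have := near B sBZ leB; rewrite !ler_norml.
move=> /andP[h1 h2] /andP[h3 h4].
rewrite !avgdegE -mulrBl; apply: (@le_trans _ _ (2 * eps * #|X|%:R)).
  by apply: ler_wpM2r => //; lra.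
by apply: ler_wpM2l; [rewrite mulr_ge0 | rewrite ler_nat subset_leq_card].
Qed.

(** * Parts lost between consecutive levels *)

(** Makes precise being almost contained in a block; the tolerance [gam] will grow by [32 * eps] per
    level. *)
Definition located (R : realType) s (V : finType) P (sg : nat -> V -> V -> bool)
    (r : nat) (gam : R) (Z : {set tower_graph s P sg}) : bool :=
  [exists x : V, #|[set u in Z | P r u.1 != P r x]|%:R <= gam * #|Z|%:R].

Lemma avgdeg_const (R : realType) (G : sgraph) (A X : {set G}) (d : nat) :
  A != set0 -> {in A, forall u, #|[set w | adj u w & w \in X]| = d} ->
  avgdeg R A X = d%:R.
Proof.
move=> A0 degA; rewrite /avgdeg edges_sum (eq_bigr _ degA) sum_nat_const natrM.
by rewrite mulrAC divff ?mul1r // pnatr_eq0 cards_eq0.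
Qed.

(** For each good label [l], the two sides [Ap l] and [An l] have average degrees into the lifted
    half block [S l] that differ by the size of the half block. Summed over [l] and over the parts,
    this gap is at least [#|V| / 64]. A regular located part [B] contributes at most
    [(gam + 2 * eps) * #|B|], and any other at most [#|B| <= 2 * #|G| / #|Z|]. Since
    [#|G| = 2 * s.+1 * #|V|], the constant is [128 * s.+1]. *)
Lemma many_irregular (R : realType) s (V : finType) P (sg : nat -> V -> V -> bool)
    r (eps gam : R) (Z : {set {set tower_graph s P sg}})
    (A : {set tower_graph s P sg}) :
  splitting_tower s.+1 P sg -> (r < s.+1)%N -> equipartition Z ->
  0 < eps -> 0 <= gam < 1 -> A \in Z -> located r gam A ->
  ~~ located r.+1 (gam + 32 * eps) A ->
  #|Z|%:R <= 128 * s.+1%:R *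
    (2 * (#|[set B in Z | ~~ regular_pair eps A B]|%:R
          + #|[set B in Z | ~~ located r gam B]|%:R) + (gam + 2 * eps) * #|Z|%:R).
Proof.
move=> tow lt_rs equiZ eps_gt0 /andP[gam_ge0 gam_lt1] AZ /existsP[x Ax] notA.
pose G := tower_graph s P sg.
have /andP[partZ _] := equiZ; have /and3P[_ _ Z0] := partZ.
have card_gt0Z (B : {set G}) : B \in Z -> 0 < #|B|%:R :> R.
  by move=> BZ; rewrite ltr0n card_gt0; apply: contraNneq Z0 => <-.
have A_gt0 := card_gt0Z A AZ.
pose A0 := [set u in A | P r u.1 == P r x].
have cardA : (#|A0| + #|[set u in A | P r u.1 != P r x]| = #|A|)%N.
  rewrite -(cardsID [set u : G | P r u.1 == P r x] A); congr (_ + _)%N.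
    by apply: eq_card => u; rewrite !inE.
  by apply: eq_card => u; rewrite !inE andbC.
have A0_neq0 : A0 != set0.
  apply/negP => /eqP A00; move: cardA; rewrite A00 cards0 add0n => cardA.
  by move: Ax; rewrite cardA; nra.
have PA0 : {in A0, forall u : G, P r u.1 = P r x}.
  by move=> u; rewrite inE => /andP[_ /eqP].
have [[u uA0 ltu]|le_good] :=
  split_or_concentrated (p := fun u : G => u.1) (eps * #|A|%:R)
    tow lt_rs A0_neq0 PA0.
  case/negP: notA; apply/existsP; exists u.1.
  (* Elements of [A] outside the child of [u] either miss the parent block ([gam]) or lie in [A0]
     outside the child ([32 * eps]). *)
  rewrite mulrDl; apply: le_trans (lerD Ax (_ : _ <= _)); last first.
    by rewrite -mulrA; exact: ltu.
  rewrite -natrD ler_nat -cardsUI; apply: leq_trans (leq_addr _ _).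
  apply/subset_leq_card/subsetP => w; rewrite !inE => /andP[-> /= ne].
  by case: eqP => //= _; rewrite eq_sym.
set good := [set y | _] in le_good.
pose Ap l := [set u in A0 | sg r u.1 l].
pose An l := [set u in A0 | ~~ sg r u.1 l].
pose gd l := (eps * #|A|%:R <= #|Ap l|%:R) && (eps * #|A|%:R <= #|An l|%:R).
pose S l := [set w : G | w.1 \in half_block P sg r x l].
pose e (B : {set G}) l :=
  avgdeg R (Ap l) (B :&: S l) - avgdeg R (An l) (B :&: S l).
have sub_block l (B : {set G}) : B :&: S l \subset [set w in B | P r w.1 == l].
  by apply/subsetP => w; rewrite !inE => /andP[-> /andP[->]].
have e_le B l : e B l <= #|[set w in B | P r w.1 == l]|%:R.
  have h1 := avgdeg_le R (Ap l) (B :&: S l).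
  have h2 := avgdeg_ge0 R (An l) (B :&: S l).
  have h3 : #|B :&: S l|%:R <= #|[set w in B | P r w.1 == l]|%:R :> R.
    by rewrite ler_nat subset_leq_card.
  by apply: le_trans h3; apply: le_trans h1; rewrite lerBlDr lerDl.
have fibers (B : {set G}) : #|B|%:R = \sum_l #|[set w in B | P r w.1 == l]|%:R
  :> R.
  by rewrite (card_fibers (fun w : G => P r w.1)) natr_sum.
have E_le B : \sum_(l | gd l) e B l <= #|B|%:R.
  rewrite fibers [X in _ <= X](bigID gd) /=; apply: ler_wpDr;
    first exact: sumr_ge0.
  exact: ler_sum.
(* All labels but that of the main block of [B] share at most [gam * #|B|] vertices; regularity
   bounds the gap for the remaining label. *)
have E_le_reg (B : {set G}) :
    B \in Z -> regular_pair eps A B -> located r gam B ->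
    \sum_(l | gd l) e B l <= (gam + 2 * eps) * #|B|%:R.
  move=> BZ reg /existsP[z Bz]; rewrite mulrDl.
  rewrite (bigID (fun l => l != P r z)) /=; apply: lerD.
    apply: le_trans Bz.
    have -> : #|[set u in B | P r u.1 != P r z]|%:R =
        \sum_(l | l != P r z) #|[set w in B | P r w.1 == l]|%:R :> R.
      rewrite (card_fibers (fun w : G => P r w.1)) natr_sum [RHS]big_mkcond /=.
      apply: eq_bigr => l _; case: ifPn => [nel|/negPn/eqP->].
        congr _%:R; apply: eq_card => w; rewrite !inE.
        by case: (P r w.1 =P l) => [->|]; rewrite ?nel ?andbT ?andbF.
      by rewrite eq_card0 // => w; rewrite !inE -andbA andNb andbF.
    rewrite big_mkcondl /=; apply: ler_sum => l _; case: ifP => // _; exact: e_le.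
  rewrite big_mkcondl /= (eq_bigl (pred1 (P r z)));
    last by move=> l; rewrite negbK.
  rewrite big_pred1_eq; case: ifP => [/andP[g1 g2]|_]; last first.
    by rewrite mulr_ge0 // mulr_ge0 // ltW.
  have sub0 : A0 \subset A by apply/subsetP => w; rewrite inE => /andP[].
  apply: regular_avgdeg_gap reg _ _ _ g1 g2; rewrite ?ltW ?subsetIl //.
    by apply: subset_trans sub0; apply/subsetP => w; rewrite inE => /andP[].
  by apply: subset_trans sub0; apply/subsetP => w; rewrite inE => /andP[].
have sum_e l : gd l -> \sum_(B in Z) e B l = #|half_block P sg r x l|%:R.
  move=> /andP[g1 g2].
  have epsA : 0 < eps * #|A|%:R by rewrite mulr_gt0.
  have neq0 (B : {set G}) : eps * #|A|%:R <= #|B|%:R -> B != set0.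
    by move=> leB; rewrite -card_gt0 -(ltr0n R); exact: lt_le_trans leB.
  have sum_avg (B : {set G}) :
      \sum_(C in Z) avgdeg R B (C :&: S l) = avgdeg R B (S l).
    by rewrite /avgdeg (edges_partition B (S l) partZ) natr_sum mulr_suml.
  rewrite sumrB !sum_avg.
  have [K degK] := card_half_block_nbr x l tow lt_rs.
  have deg u : u \in A0 -> #|[set w | adj u w & w \in S l]| =
      (K + sg r u.1 l * #|half_block P sg r x l|)%N.
    by move=> /PA0/degK <-; apply: eq_card => w; rewrite !inE.
  rewrite (@avgdeg_const R G (Ap l) (S l) (K + #|half_block P sg r x l|)) ?neq0
    //; last first.
    by move=> u; rewrite inE => /andP[/deg-> ->]; rewrite mul1n.
  rewrite (@avgdeg_const R G (An l) (S l) K) ?neq0 //; last first.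
    by move=> u; rewrite inE => /andP[/deg-> /negPf->]; rewrite mul0n addn0.
  by rewrite natrD addrC addKr.
(* Whether [y] is good depends only on its block, so [good] is a union of blocks, each twice its
   half block. *)
have half_good :
    #|good|%:R = 2 * \sum_(l | gd l) #|half_block P sg r x l|%:R :> R.
  rewrite -natr_sum -natrM; congr _%:R.
  rewrite (card_fibers (P r)) big_distrr [RHS]big_mkcond /=;
  apply: eq_bigr => l _.
  rewrite mul2n (tower_balanced tow) //; case: ifPn => gl.
    by apply: eq_card => y; rewrite !inE; apply: andb_idl => /eqP->.
  apply: eq_card0 => y; rewrite !inE; apply: contraNF gl => /andP[h /eqP<-];
    exact: h.
have lower : #|V|%:R <= 64 * \sum_(B in Z) \sum_(l | gd l) e B l.
  rewrite exchange_big /= (eq_bigr _ sum_e); move: le_good; rewrite half_good;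
    lra.
pose bad (B : {set G}) := ~~ regular_pair eps A B || ~~ located r gam B.
have size_le B : B \in Z -> #|B|%:R * #|Z|%:R <= 2 * #|G|%:R :> R.
  by move=> BZ; rewrite -!natrM ler_nat; exact: equipartition_card.
have Z_gt0 : 0 < #|Z|%:R :> R by rewrite ltr0n; apply/card_gt0P; exists A.
have V_gt0 : 0 < #|V|%:R :> R by rewrite ltr0n; apply/card_gt0P; exists x.
have cardG : #|G|%:R = #|V|%:R * (2 * s.+1%:R) :> R.
  by rewrite -!natrM card_prod card_prod card_ord card_bool; congr (_ * _)%:R;
    rewrite mulnC.
have c_ge0 : 0 <= gam + 2 * eps by rewrite addr_ge0 // mulr_ge0 // ltW.
have upper : #|Z|%:R * \sum_(B in Z) \sum_(l | gd l) e B l <=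
    (2 * #|[set B in Z | bad B]|%:R + (gam + 2 * eps) * #|Z|%:R) * #|G|%:R.
  have card_bad : #|[set B in Z | bad B]|%:R = \sum_(B in Z) (bad B)%:R :> R.
    rewrite -natr_sum -sum1_card; congr _%:R.
    rewrite [LHS]big_mkcond [RHS]big_mkcond /=; apply: eq_bigr => B _.
    by rewrite inE; case: (B \in Z); case: (bad B).
  have sumG : \sum_(B in Z) #|B|%:R = #|G|%:R :> R.
    by rewrite -natr_sum -cardsT (card_partition partZ).
  rewrite mulrDl -[in X in _ <= _ + X]sumG mulr_sumr mulr_sumr.
  rewrite (_ : 2 * _ * _ = \sum_(B in Z) (bad B)%:R * (2 * #|G|%:R)); last first.
    by rewrite -mulr_suml -card_bad; ring.
  rewrite -big_split /=; apply: ler_sum => B BZ; rewrite mulrC.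
  case: (boolP (bad B)) => [_|]; rewrite ?mul1r ?mul0r ?add0r.
    apply: ler_wpDr; first by rewrite !mulr_ge0.
    apply: le_trans (size_le B BZ); exact: ler_wpM2r.
  rewrite negb_or !negbK => /andP[regB locB].
  by rewrite mulrAC ler_wpM2r // E_le_reg.
have bad_le : #|[set B in Z | bad B]|%:R <=
    #|[set B in Z | ~~ regular_pair eps A B]|%:R
      + #|[set B in Z | ~~ located r gam B]|%:R :> R.
  rewrite -natrD ler_nat -cardsUI; apply: leq_trans (leq_addr _ _).
  by apply/subset_leq_card/subsetP => B; rewrite !inE /bad -andb_orr.
have main : #|V|%:R * #|Z|%:R <= #|V|%:R * (128 * s.+1%:R *
    (2 * #|[set B in Z | bad B]|%:R + (gam + 2 * eps) * #|Z|%:R)).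
  apply: le_trans (ler_wpM2r _ lower) _ => //.
  rewrite -[X in X <= _]mulrA [X in _ * X <= _]mulrC.
  apply: le_trans (ler_wpM2l _ upper) _ => //.
  by rewrite cardG le_eqVlt; apply/orP; left; apply/eqP; ring.
rewrite ler_pM2l // in main; apply: le_trans main _.
by rewrite ler_wpM2l ?mulr_ge0 // lerD2r ler_wpM2l.
Qed.

(** * Numerical estimates *)

Lemma cube_le_lower_powers (R : realFieldType) (eps sig : R) :
  0 < eps -> 1 <= sig -> 512 * 1024 * (eps * sig ^+ 3) <= 1 ->
  512 * 1024 * (eps * sig ^+ 2) <= 1 /\ 512 * 1024 * (eps * sig) <= 1.
Proof.
move=> eps_gt0 sig_ge1 small; have sig_ge0 := le_trans ler01 sig_ge1.
have esig2 : 512 * 1024 * (eps * sig ^+ 2) <= 1.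
  apply: le_trans small; rewrite ler_wpM2l ?mulr_ge0 // ler_pM2l //.
  by rewrite [leRHS]exprS ler_peMl // exprn_ge0.
split=> //; apply: le_trans esig2; rewrite ler_wpM2l ?mulr_ge0 // ler_pM2l //.
by rewrite expr2 ler_peMl.
Qed.

Lemma threshold_lt1 (R : realFieldType) (eps sig r : R) :
  0 < eps -> 1 <= sig -> 512 * 1024 * (eps * sig ^+ 3) <= 1 ->
  0 <= r -> r + 1 <= sig -> 0 <= 32 * eps * r < 1.
Proof.
move=> eps_gt0 sig_ge1 small r_ge0 r_lt.
have [_ esig] := cube_le_lower_powers eps_gt0 sig_ge1 small.
have er_le : eps * (r + 1) <= eps * sig by rewrite ler_pM2l.
have er_ge0 : 0 <= eps * r by rewrite mulr_ge0 // ltW.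
by apply/andP; split; lra.
Qed.

(** Absorbs the error terms of [many_irregular]: the one in [b] is at most [k / 4], the one in [eps]
    at most [k / 8]. The bound on [b] carries [sig * eps * r] and gets multiplied by [sig], whence
    the cube and the constant [512 * 1024]. *)
Lemma irregular_lower_bound (R : realFieldType) (eps sig r k b i : R) :
  0 < eps -> 1 <= sig -> 512 * 1024 * (eps * sig ^+ 3) <= 1 ->
  0 <= r -> r + 1 <= sig -> 0 <= k -> b <= 512 * sig * eps * r * k ->
  k <= 128 * sig * (2 * (i + b) + (32 * eps * r + 2 * eps) * k) ->
  k <= 512 * sig * i.
Proof.
move=> eps_gt0 sig_ge1 small r_ge0 r_lt k_ge0 b_le main.
have sig_ge0 := le_trans ler01 sig_ge1.
have [esig2 _] := cube_le_lower_powers eps_gt0 sig_ge1 small.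
have er_le : eps * (r + 1) <= eps * sig by rewrite ler_pM2l.
have h1 : 1024 * sig * b <= k.
  apply: le_trans (ler_wpM2l _ b_le) _; first by rewrite mulr_ge0.
  rewrite [leLHS](_ : _ = 512 * 1024 * (sig ^+ 2 * (eps * r)) * k); last by ring.
  rewrite -[leRHS]mul1r ler_wpM2r //; apply: le_trans small.
  rewrite ler_wpM2l ?mulr_ge0 // [leRHS](_ : _ = sig ^+ 2 * (eps * sig));
    last by ring.
  by rewrite ler_wpM2l ?exprn_ge0 // ler_pM2l //; lra.
have h2 : 1024 * sig * ((32 * eps * r + 2 * eps) * k) <= k.
  rewrite mulrA -[leRHS]mul1r ler_wpM2r //; apply: le_trans esig2.
  rewrite [leRHS](_ : _ = 1024 * sig * (512 * (eps * sig))); last by ring.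
  have e_lt : 32 * eps * r + 2 * eps <= 512 * (eps * sig).
    have : 0 <= eps * r by rewrite mulr_ge0 // ltW.
    by clear -er_le eps_gt0; lra.
  by rewrite ler_wpM2l ?mulr_ge0.
by clear -main h1 h2 k_ge0; lra.
Qed.

(** * Descent through the levels and the final bound *)

(** Induction on [r], starting from the single block of level 0. Each part newly lost has at least
    [k / (512 * sig)] irregular partners, and there are at most [eps * k^2] irregular pairs, so one
    level loses at most [512 * sig * eps * k] parts. *)
Lemma few_unlocated (R : realType) s (V : finType) P (sg : nat -> V -> V -> bool)
    (eps : R) (Z : {set {set tower_graph s P sg}}) r :
  splitting_tower s.+1 P sg -> 0 < eps ->
  512 * 1024 * (eps * s.+1%:R ^+ 3) <= 1 ->
  regular_equipartition eps Z -> (r <= s.+1)%N ->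
  #|[set B in Z | ~~ located r (32 * eps * r%:R) B]|%:R
    <= 512 * s.+1%:R * eps * r%:R * #|Z|%:R.
Proof.
move=> tow eps_gt0 small /andP[equiZ irr_le].
have /andP[partZ _] := equiZ; have /and3P[_ _ Z0] := partZ.
set sig : R := s.+1%:R in small *; set k : R := #|Z|%:R.
have sig_ge1 : 1 <= sig by rewrite ler1n.
have k_ge0 : 0 <= k by exact: ler0n.
elim: r => [_|r IH lt_rs].
  rewrite eq_card0; first by rewrite mulr0 mul0r.
  move=> B; rewrite inE.
  case: (boolP (B \in Z)) => //= BZ; apply/negbTE; rewrite negbK.
  have /set0Pn[u uB] : B != set0 by apply: contraNneq Z0 => <-.
  apply/existsP; exists u.1; rewrite mulr0 mul0r eq_card0 // => w.
  by rewrite inE (tower_root tow w.1 u.1) eqxx andbF.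
have {IH} := IH (ltnW lt_rs).
set b : R := #|[set B in Z | ~~ located r _ B]|%:R => b_le.
have r_lt : r%:R + 1 <= sig by rewrite natr1 ler_nat.
have r_ge0 : 0 <= r%:R :> R by [].
pose New := [set A in Z | located r (32 * eps * r%:R) A
  && ~~ located r.+1 (32 * eps * r.+1%:R) A].
pose irr A := [set B in Z | ~~ regular_pair eps A B].
have irr_ge A : A \in New -> k <= 512 * sig * #|irr A|%:R.
  rewrite inE => /and3P[AZ locA nlocA].
  have gam01 : 0 <= 32 * eps * r%:R < 1 by exact: threshold_lt1 small _ _.
  have nlocA' : ~~ located r.+1 (32 * eps * r%:R + 32 * eps) A.
    by rewrite -[X in _ + X]mulr1 -mulrDr natr1.
  have := many_irregular tow lt_rs equiZ eps_gt0 gam01 AZ locA nlocA'.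
  rewrite -/k -/b -/sig -/(irr A) => main.
  exact: irregular_lower_bound small _ _ _ b_le main.
have New_le : #|New|%:R * k <= 512 * sig * eps * k ^+ 2.
  apply: (@le_trans _ _ (512 * sig * \sum_(A in New) #|irr A|%:R)).
    rewrite mulr_sumr mulr_natl -sumr_const; exact: ler_sum.
  rewrite -!mulrA ler_pM2l // ler_pM2l ?(lt_le_trans ltr01) //.
  apply: le_trans irr_le; rewrite -natr_sum ler_nat.
  have -> : #|[set p in setX Z Z | ~~ regular_pair eps p.1 p.2]| =
      (\sum_(A in Z) #|irr A|)%N.
    rewrite -sum1dep_card (eq_bigl (fun p : {set _} * {set _} =>
      (p.1 \in Z) && ((p.2 \in Z) && ~~ regular_pair eps p.1 p.2))); last first.
      by move=> p; rewrite !inE andbA.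
    rewrite -(pair_big_dep (mem Z) (fun A B =>
      (B \in Z) && ~~ regular_pair eps A B)
      (fun _ _ => 1%N)) /=.
    by apply: eq_bigr => A _; rewrite -sum1dep_card.
  rewrite big_mkcond [leqRHS]big_mkcond /=; apply: leq_sum => A _.
  by rewrite inE; case: (A \in Z) => //=; case: ifP.
have {}New_le : #|New|%:R <= 512 * sig * eps * k.
  have [k0|k_neq0] := eqVneq k 0.
    rewrite k0 mulr0 -k0 ler_nat; apply/subset_leq_card/subsetP => A.
    by rewrite inE => /andP[].
  have k_gt0 : 0 < k by rewrite lt_neqAle eq_sym k_neq0.
  by rewrite -(ler_pM2r k_gt0) [leRHS](_ : _ = 512 * sig * eps * k ^+ 2) //; ring.
rewrite -[X in _ * X * k]natr1 mulrDr mulrDl mulr1.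
apply: le_trans (lerD b_le New_le); rewrite -natrD ler_nat -cardsUI.
apply: leq_trans (leq_addr _ _); apply/subset_leq_card/subsetP => A; rewrite !inE.
by move=> /andP[-> ->] /=; rewrite andbT orNb.
Qed.

(** At the last level the lost proportion is below 1, so some part lies, up to half of its size, in
    the fibre of one vertex, which has [2 * s.+1] elements. That part has at most [4 * s.+1]
    elements, hence every part at most [8 * s.+1], while the graph has [2 * s.+1 * #|V|]
    vertices. *)
Lemma card_regular_tower_partition (R : realType) s (V : finType) P
    (sg : nat -> V -> V -> bool) (eps : R) (Z : {set {set tower_graph s P sg}}) :
  splitting_tower s.+1 P sg -> 0 < eps ->
  512 * 1024 * (eps * s.+1%:R ^+ 3) <= 1 ->
  regular_equipartition eps Z -> (#|V| <= 4 * #|Z|)%N.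
Proof.
move=> tow eps_gt0 small regZ; have /andP[equiZ _] := regZ.
have /andP[partZ /forall_inP eqZ] := equiZ.
have unloc := few_unlocated tow eps_gt0 small regZ (leqnn _).
set sig : R := s.+1%:R in small unloc; set k : R := #|Z|%:R in unloc.
have sig_ge1 : 1 <= sig by rewrite ler1n.
have [esig2 esig] := cube_le_lower_powers eps_gt0 sig_ge1 small.
have [V0|/card_gt0P[v _]] := posnP #|V|; first by rewrite V0.
have k_gt0 : 0 < k.
  rewrite ltr0n lt0n; apply/eqP => /eqP; rewrite cards_eq0 => /eqP Z_0.
  have := card_partition partZ; rewrite Z_0 big_set0 => /eqP; rewrite cards_eq0.
  by move=> /eqP/setP/(_ (v, (ord0, false))); rewrite !inE.
have [B BZ /existsP[x locB]] :
    exists2 B, B \in Z & located s.+1 (32 * eps * sig) B.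
  apply/exists_inP; rewrite -[X in is_true X]negbK negb_exists_in;
    apply/negP => /forall_inP none.
  move: unloc; apply/negP; rewrite -ltNge.
  have -> : [set B in Z | ~~ located s.+1 (32 * eps * sig) B] = Z.
    by apply/setP => B; rewrite inE; apply: andb_idr => /none.
  rewrite -/k -[ltRHS]mul1r ltr_pM2r //.
  rewrite (_ : _ * _ * _ * _ = 512 * (eps * sig ^+ 2)); last by ring.
  lra.
have B_le : (#|B| <= 4 * s.+1)%N.
  have cardB : (#|[set u in B | u.1 == x]|
      + #|[set u in B | P s.+1 u.1 != P s.+1 x]| = #|B|)%N.
    rewrite -(cardsID [set u : tower_graph s P sg | u.1 == x] B); congr (_ + _)%N.
      by apply: eq_card => u; rewrite !inE.
    by apply: eq_card => u; rewrite !inE !(tower_leaf tow) andbC.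
  have fib : (#|[set u in B | u.1 == x]| <= 2 * s.+1)%N.
    apply: (@leq_trans #|[set u : V * ('I_s.+1 * bool) | u.1 == x]|).
      by apply/subset_leq_card/subsetP => u; rewrite !inE => /andP[].
    rewrite (card_preim_fst _ (pred1 x)) card_prod card_ord card_bool.
    by rewrite (_ : [set _ | _] = [set x]) ?cards1 ?mul1n ?[(s.+1 * 2)%N]mulnC
      //; apply/setP => y; rewrite !inE.
  have : (2 * #|[set u in B | P s.+1 u.1 != P s.+1 x]| <= #|B|)%N.
    rewrite -(ler_nat R) natrM; have : 0 <= #|B|%:R :> R by [].
    move: locB; nra.
  by move: cardB fib; clear; lia.
have Z_le A : A \in Z -> (#|A| <= 8 * s.+1)%N.
  by move=> AZ; move: (eqZ A AZ) => /forall_inP/(_ B BZ); move: B_le; clear; lia.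
have := card_partition partZ;
  rewrite cardsT card_prod card_prod card_ord card_bool.
have : (\sum_(A in Z) #|A| <= \sum_(A in Z) 8 * s.+1)%N by exact: leq_sum.
rewrite sum_nat_const => le1 eq1; rewrite -eq1 in le1.
by rewrite -(@leq_pmul2r (2 * s.+1)) //; move: le1; clear; lia.
Qed.

Theorem mainTheorem1 (R : realType) :
  exists2 eps0 : R, 0 < eps0 &
    forall (eps : R) (M : nat), 0 < eps -> eps < eps0 ->
      regularity_bound eps M -> (twr (1 / (eps `^ (1 / 6))) <= M)%N.
Proof.
(* [2^-54 = (1/512)^6], so that [t = eps^(1/6)] is at most [1/512]. *)
exists (2^-1 ^+ 54); first by rewrite exprn_gt0 // invr_gt0.
move=> eps M eps_gt0 lt_eps bound.
pose t := eps `^ (1 / 6).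
have t_gt0 : 0 < t by exact: powR_gt0.
have t6 : t ^+ 6 = eps.
  by rewrite /t -powR_mulrn ?powR_ge0 // -powRrM divfK ?pnatr_eq0 // powRr1
    // ltW.
have t_le : 512 * t <= 1.
  rewrite -ler_pdivlMl // mulr1 leNgt; apply/negP => lt_t.
  move: lt_eps; apply/negP; rewrite -leNgt -t6.
  rewrite (_ : 2^-1 ^+ 54 = 512^-1 ^+ 6); last by field.
  by rewrite ler_pXn2r ?nnegrE ?invr_ge0 // ltW.
pose h := `|Num.ceil (1 / t)|%N.
have h_lt : h%:R < 1 / t + 1.
  have : 0 <= Num.ceil (1 / t).
    by rewrite ceil_ge0 (lt_trans _ (divr_gt0 ltr01 t_gt0)) // ltrN10.
  rewrite /h => ge0; rewrite natr_absz ger0_norm //.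
  by have := ceilB1_lt (1 / t); rewrite intrB ltrBlDr.
have [V [P [sg [tow le_V]]]] := exists_tower h.
(* Of [eps = t^6], three factors [t] cancel the cubed number of levels, as
   [t * h.+2 <= 1 + 3 * t <= 4]; the other three absorb the constants. *)
have small : 512 * 1024 * (eps * h.+2%:R ^+ 3) <= 1.
  have ht : t * h.+2%:R <= 4.
    have : t * h%:R <= t * (1 / t + 1) by rewrite ler_pM2l // ltW.
    rewrite mulrDr mulr1 div1r divff ?gt_eqF // -addn2 natrD; lra.
  rewrite -t6 [leLHS](_ : _ = 256^-1 * ((512 * t) ^+ 3 * (t * h.+2%:R) ^+ 3));
    last by field.
  have h1 : (512 * t) ^+ 3 <= 1 by rewrite exprn_ile1 // mulr_ge0 // ltW.
  have h2 : (t * h.+2%:R) ^+ 3 <= 4 ^+ 3.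
    by apply: lerXn2r ht; rewrite nnegrE ?mulr_ge0 // ltW.
  have h3 : (512 * t) ^+ 3 * (t * h.+2%:R) ^+ 3 <= 1 * 4 ^+ 3.
    by apply: ler_pM h1 h2; rewrite exprn_ge0 // mulr_ge0 // ltW.
  lra.
have [Z regZ leZ] := bound (tower_graph h.+1 P sg).
have := card_regular_tower_partition tow eps_gt0 small regZ.
rewrite /twr -/t -/h; move: le_V leZ; clear; lia.
Qed.
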